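(* Let $F$ be a free group of rank $r$ freely generated by $x_1,\dots,x_r$, let $\widetilde{\mathbb N}\equiv\mathbb N$ with corresponding ring $\widetilde{\mathbb Z}\equiv\mathbb Z$, and let $\widetilde F=F(\widetilde{\mathbb N})$ be the corresponding nonstandard free group. Then centralizers in $\widetilde F$ are isomorphic to the additive group $\widetilde{\mathbb Z}^+$ of $\widetilde{\mathbb Z}$.
   Context: $\mathbb N=\langle\mathbb N;+,\cdot,0,1\rangle$. For $\widetilde{\mathbb N}\equiv\mathbb N$, the corresponding $\widetilde{\mathbb Z}\equiv\mathbb Z$ is the ring whose set of non-negative elements is $\widetilde{\mathbb N}$. ''Centralizers'' means centralizers of elements of $\widetilde F$. Nonstandard tuples: fix a computable bijective enumeration of all finite tuples of natural numbers by natural numbers, and arithmetic formulas $T(n,a,i)$ (''the $i$-th component of the $n$-th tuple is $a$'') and $L(n,k)$ (''the $n$-th tuple has length $k$''). A nonstandard tuple over $\widetilde{\mathbb N}$ is a function $s:[1,k]\to\widetilde{\mathbb N}$, $k\in\widetilde{\mathbb N}$, such that for some $n\in\widetilde{\mathbb N}$ one has $\widetilde{\mathbb N}\models L(n,k)$ and the graph of $s$ is given by the truth set of $T(n,a,i)$ in $\widetilde{\mathbb N}$. Nonstandard tuples over $\widetilde{\mathbb Z}$ are defined likewise (coding integers by natural numbers). Nonstandard free group: $F$ is interpreted in arithmetic by letting a reduced word $x_{i_1}^{\varepsilon_1}\cdots x_{i_n}^{\varepsilon_n}$ correspond to the tuple $(\varepsilon_1i_1,\dots,\varepsilon_ni_n)$.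 $\widetilde F=F(\widetilde{\mathbb N})$ is the group defined by the same formulas over $\widetilde{\mathbb N}$: its elements are the nonstandard tuples $(a_1,\dots,a_n)$ over $\widetilde{\mathbb Z}$, $n\in\widetilde{\mathbb N}$ (including the empty tuple, the identity), with $1\le|a_i|\le r$ for all $i$ and $a_i\ne-a_{i+1}$ for $1\le i\le n-1$; the product is concatenation followed by removal of the maximal cancelling segment $(d_\ell,\dots,d_1,-d_1,\dots,-d_\ell)$ symmetric about the concatenation point; $(a_1,\dots,a_n)^{-1}=(-a_n,\dots,-a_1)$.
   Formalization: The centralizers are taken of nontrivial elements only: the centralizer of the identity is the whole nonstandard free group, which for r ≥ 2 is nonabelian (and for r = 0 trivial), hence not isomorphic to the additive group of the ring. *)

(* Defs.v *)
From mathcomp Require Import all_boot all_order all_algebra.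

Set Implicit Arguments.
Unset Strict Implicit.
Unset Printing Implicit Defensive.

Import Order.TTheory GRing.Theory Num.Theory.

(* First-order logic in the signature (+, *, 0, 1). Formulas are well-scoped
   de Bruijn terms: [formula n] has its free variables among 0, ..., n-1, and
   under a quantifier the bound variable is 0. *)

Inductive term (n : nat) : Type :=
| Var of 'I_n
| Zero
| One
| Add of term n & term n
| Mul of term n & term n.

Inductive formula : nat -> Type :=
| Eq n of term n & term n : formula n
| Neg n of formula n : formula n
| And n of formula n & formula n : formula n
| Or n of formula n & formula n : formula n
| Imp n of formula n & formula n : formula n
| All n of formula n.+1 : formula n
| Ex n of formula n.+1 : formula n.

Record arith : Type := Arith {
  carrier :> Type;
  aadd : carrier -> carrier -> carrier;
  amul : carrier -> carrier -> carrier;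
  azero : carrier;
  aone : carrier }.

Definition natA : arith := Arith addn muln 0 1.

Definition scons (X : Type) n (x : X) (v : 'I_n -> X) : 'I_n.+1 -> X :=
  fun i => if unlift ord0 i is Some j then v j else x.

Fixpoint eval (M : arith) n (v : 'I_n -> M) (t : term n) : M :=
  match t with
  | Var i => v i
  | Zero => azero M
  | One => aone M
  | Add t1 t2 => aadd (eval v t1) (eval v t2)
  | Mul t1 t2 => amul (eval v t1) (eval v t2)
  end.

Fixpoint sat (M : arith) n (f : formula n) : ('I_n -> M) -> Prop :=
  match f in formula n return ('I_n -> M) -> Prop with
  | Eq _ t1 t2 => fun v => eval v t1 = eval v t2
  | Neg _ f1 => fun v => ~ sat f1 v
  | And _ f1 f2 => fun v => sat f1 v /\ sat f2 v
  | Or _ f1 f2 => fun v => sat f1 v \/ sat f2 v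
  | Imp _ f1 f2 => fun v => sat f1 v -> sat f2 v
  | All _ f1 => fun v => forall x : M, sat f1 (scons x v)
  | Ex _ f1 => fun v => exists x : M, sat f1 (scons x v)
  end.

Definition elem_equiv (M1 M2 : arith) : Prop :=
  forall f : formula 0,
    sat (M := M1) f (tnth [tuple]) <-> sat (M := M2) f (tnth [tuple]).

(* The total recursive functions: the closure of the basic functions under
   composition, primitive recursion and minimization of regular functions. *)

Inductive recursive : forall k, (k.-tuple nat -> nat) -> Prop :=
| rec_zero : recursive (fun _ : 0.-tuple nat => 0)
| rec_succ : recursive (fun v : 1.-tuple nat => (thead v).+1)
| rec_proj k (i : 'I_k) : recursive (fun v : k.-tuple nat => tnth v i)
| rec_comp k m (f : m.-tuple nat -> nat) (g : 'I_m -> k.-tuple nat -> nat) :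
    recursive f -> (forall i, recursive (g i)) ->
    recursive (fun v => f [tuple g i v | i < m])
| rec_prim k (f : k.-tuple nat -> nat) (g : k.+2.-tuple nat -> nat)
    (h : k.+1.-tuple nat -> nat) :
    recursive f -> recursive g ->
    (forall v : k.-tuple nat, h [tuple of 0 :: v] = f v) ->
    (forall n (v : k.-tuple nat), h [tuple of n.+1 :: v] =
                 g [tuple of [:: n, h [tuple of n :: v] & v]]) ->
    recursive h
| rec_min k (f : k.+1.-tuple nat -> nat) (h : k.-tuple nat -> nat) :
    recursive f ->
    (forall v : k.-tuple nat, f [tuple of h v :: v] = 0 /\
               forall n, n < h v -> f [tuple of n :: v] <> 0) ->
    recursive h
| rec_ext k (f g : k.-tuple nat -> nat) :
    f =1 g -> recursive f -> recursive g.

Definition computable_enum (e : nat -> seq nat) : Prop :=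
  recursive (fun v : 1.-tuple nat => size (e (thead v))) /\
  recursive (fun v : 2.-tuple nat => nth 0 (e (tnth v ord0)) (tnth v ord_max)).

(* Truth of T(n, a, i) and L(n, k); positions in tuples are counted from 1. *)

Definition satT (M : arith) (T : formula 3) (n a i : M) : Prop :=
  sat T (tnth [tuple n; a; i]).

Definition satL (M : arith) (L : formula 2) (n k : M) : Prop :=
  sat L (tnth [tuple n; k]).

Definition defines_components (e : nat -> seq nat) (T : formula 3) : Prop :=
  forall n a i : nat, satT (M := natA) T n a i <->
    [/\ 0 < i, i <= size (e n) & nth 0 (e n) i.-1 = a].

Definition defines_length (e : nat -> seq nat) (L : formula 2) : Prop :=
  forall n k : nat, satL (M := natA) L n k <-> size (e n) = k.

Definition ale (M : arith) (x y : M) : Prop := exists z : M, aadd x z = y.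

Definition in1 (M : arith) (k i : M) : Prop := ale (aone M) i /\ ale i k.

Local Open Scope ring_scope.

Section NonstandardFreeGroup.

Variables (M : arith) (Z : realDomainType) (iota : M -> Z).

(* Z is the ordered ring whose non-negative elements are M, via iota. *)
Record ring_of : Prop := RingOf {
  iota_inj : injective iota;
  iota0 : iota (azero M) = 0;
  iota1 : iota (aone M) = 1;
  iotaD : forall x y, iota (aadd x y) = iota x + iota y;
  iotaM : forall x y, iota (amul x y) = iota x * iota y;
  iota_nonneg : forall z : Z, 0 <= z <-> exists n, iota n = z }.

Variables (T : formula 3) (L : formula 2).

(* The restriction of s to [1, k] is a nonstandard tuple over M. *)
Definition nonstd_tuple (k : M) (s : M -> M) : Prop :=
  exists n : M, satL L n k /\
    forall a i, satT T n a i <-> in1 k i /\ s i = a.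

(* The coding 0, -1, 1, -2, 2, ... |-> 0, 1, 2, 3, 4, ... of integers. *)
Definition zcode (z : Z) : Z := if 0 <= z then z *+ 2 else - z *+ 2 - 1.

Definition nonstd_ztuple (k : M) (s : M -> Z) : Prop :=
  exists2 t : M -> M, nonstd_tuple k t &
    forall i, in1 k i -> iota (t i) = zcode (s i).

(* A function [1, len] -> Z is represented by its extension by 0 to M; see
   [w_out] below, which makes the representation unique. *)
Record word : Type := Word { len : M; letter : M -> Z }.

Record nonstd_word (r : nat) (s : word) : Prop := NonstdWord {
  w_tuple : nonstd_ztuple (len s) (letter s);
  w_out : forall i, ~ in1 (len s) i -> letter s i = 0;
  w_range : forall i, in1 (len s) i -> 1 <= `|letter s i| <= r%:R;
  w_reduced : forall i, ale (aone M) i -> ale (aadd i (aone M)) (len s) ->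
    letter s i <> - letter s (aadd i (aone M)) }.

Definition wone : word := Word (azero M) (fun=> 0).

(* The last l letters of s are d_l, ..., d_1 and the first l letters of t are
   -d_1, ..., -d_l. *)
Definition cancels (s t : word) (l : M) : Prop :=
  [/\ ale l (len s), ale l (len t) &
      forall i j, in1 l j -> aadd i j = aadd (len s) (aone M) ->
        letter t j = - letter s i].

(* u is the product of s = s' d_l ... d_1 and t = -d_1 ... -d_l t' with l
   maximal, i.e. u = s' t', where c and d are the lengths of s' and t'. *)
Definition wmul (s t u : word) : Prop :=
  exists l c d : M,
    [/\ cancels s t l /\ (forall l', cancels s t l' -> ale l' l),
        len s = aadd c l /\ len t = aadd l d,
        len u = aadd c d,
        forall i, in1 c i -> letter u i = letter s i &
        forall i, in1 d i -> letter u (aadd c i) = letter t (aadd l i)].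

Definition centralizer (r : nat) (g h : word) : Prop :=
  nonstd_word r h /\
  exists u, [/\ nonstd_word r u, wmul g h u & wmul h g u].

(* The set C of words, with the product of words, is isomorphic to the additive
   group of Z. *)
Definition isog_Zplus (C : word -> Prop) : Prop :=
  exists f : Z -> word,
    [/\ injective f,
        forall h, C h <-> exists z, f z = h &
        forall z1 z2, wmul (f z1) (f z2) (f (z1 + z2))].

End NonstandardFreeGroup.

(* Main.v *)
(** In a free group, an element commuting with a cyclically reduced word [w]
    has, up to inversion, no cancellation with [w], so the two commute already in
    the free monoid and are powers of a common word.  After conjugation, every
    nontrivial centralizer is infinite cyclic, and for a generator [k] the length
    of [k ^ n], [n > 0], is an affine function [m + n * l] of [n].  The relation
    [u = k ^ p * k ^ (- q)] is therefore definable from the product and the length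
    of words, without any coding of the recursion that defines powers.  That this
    relation identifies the centralizer with the group of differences [p - q] is
    then a first-order sentence about codes of words; it is true in the standard
    model, hence in every model elementarily equivalent to it. *)
From HB Require Import structures.
Require Import Defs.
From mathcomp Require Import all_boot all_order all_algebra.
From mathcomp Require Import zify lra.
From Stdlib Require Import Setoid FunctionalExtensionality Classical ClassicalEpsilon.

Set Implicit Arguments.
Unset Strict Implicit.
Unset Printing Implicit Defensive.

(** * Centralizers in the free group *)

Section FreeMonoid.

Variable A : eqType.
Implicit Types (h u w : seq A) (n : nat).

Definition wpow h n := flatten (nseq n h).

Lemma wpowS h n : wpow h n.+1 = h ++ wpow h n.
Proof. by []. Qed.

Lemma wpowSr h n : wpow h n.+1 = wpow h n ++ h.
Proof.
by elim: n => [|n IHn]; [rewrite /wpow /= cats0 | rewrite wpowS {1}IHn catA].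
Qed.

Lemma size_wpow h n : size (wpow h n) = n * size h.
Proof. by elim: n => // n IHn; rewrite wpowS size_cat IHn mulSn. Qed.

(** Take for [h] the shortest nonempty prefix of [w] that commutes with [w]. A word commuting with
    [w] and shorter than [h] is again a prefix of [w], hence empty by minimality; a longer one
    starts with [h], and removing this [h] leaves a shorter commuting word. *)
Lemma free_monoid_commute w : w != [::] ->
  exists2 h, h != [::] &
    forall u, u ++ w = w ++ u <-> exists n, u = wpow h n.
Proof.
move=> w0.
pose P k := has (fun i => (i == k) && (0 < k) &&
  (take k w ++ w == w ++ take k w)) (iota 0 (size w).+1).
have PE k : P k = [&& 0 < k, k <= size w & take k w ++ w == w ++ take k w].
  apply/hasP/idP => [[i]|/and3P[k0 kw e]].
    by rewrite mem_iota add0n ltnS /= => ilt /andP[/andP[/eqP<- ->] ->]; rewrite ilt.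
  by exists k; rewrite ?mem_iota ?eqxx ?k0.
have w_gt0 : 0 < size w by case: (w) w0.
have exP : exists k, P k.
  by exists (size w); rewrite PE w_gt0 leqnn take_size eqxx.
case: (ex_minnP exP) => k; rewrite PE => /and3P[k0 kw /eqP comm_h] min_k.
pose h := take k w; have sz_h : size h = k by rewrite size_takel.
exists h; first by rewrite -size_eq0 sz_h -lt0n.
have comm_take u : u ++ w = w ++ u -> size u < k -> u = [::].
  move=> comm_u lt_uk.
  have u_take : u = take (size u) w.
    have := congr1 (take (size u)) comm_u.
    by rewrite take_size_cat // takel_cat // ltnW // (leq_trans lt_uk).
  apply/eqP; rewrite -size_eq0 eqn0Ngt; apply/negP => u0.
  have := min_k (size u); rewrite PE u0 -u_take comm_u eqxx andbT /=.
  by rewrite (leq_trans (ltnW lt_uk) kw) leqNgt lt_uk => /(_ isT).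
move=> u; split=> [|[n ->]]; last first.
  elim: n => [|n IHn]; first by rewrite cats0.
  by rewrite wpowS -catA IHn catA comm_h catA.
have [m] := ubnP (size u); elim: m u => // m IHm u; rewrite ltnS => le_um comm_u.
have [lt_uk|le_ku] := ltnP (size u) k; first by exists 0; exact: comm_take.
have [u' u_def] : exists u', u = h ++ u'.
  exists (drop k u); rewrite -[LHS](cat_take_drop k); congr (_ ++ _).
  have := congr1 (take k) comm_u.
  by rewrite takel_cat // takel_cat.
have comm_u' : u' ++ w = w ++ u'.
  move: comm_u; rewrite u_def -catA [in RHS]catA -comm_h -!catA => /eqP.
  by rewrite eqseq_cat // eqxx => /eqP.
have [|n u'_def] := IHm u' _ comm_u'; last by exists n.+1; rewrite wpowS -u'_def.
by apply: leq_trans le_um; rewrite u_def size_cat sz_h -[ltnLHS]add0n ltn_add2r.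
Qed.

End FreeMonoid.

(** * Reduced words and cyclic reduction *)

Section ReducedWords.

(* Letters are the nonzero codes of [zcode]: 2i stands for i and 2i - 1 for -i. *)
Definition bar a := if odd a then a.+1 else a.-1.
Definition alpha r a := 0 < a <= r.*2.
Definition noncancel a b := b != bar a.
Definition red r s := all (alpha r) s && sorted noncancel s.

Lemma barK : involutive bar.
Proof. by rewrite /bar; case=> [//|a]; rewrite /=; case: (boolP (odd a)) => /= ->. Qed.

Lemma alpha_bar r a : alpha r (bar a) = alpha r a.
Proof. rewrite /alpha /bar; case: ifP; lia. Qed.

Lemma noncancelaa r a : alpha r a -> noncancel a a.
Proof. rewrite /alpha /noncancel /bar; case: ifP; lia. Qed.

(** Left multiplication of a reduced word by one letter. Building the product from it makes
    associativity an induction on letters; the agreement with the removal of a maximal cancelling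
    segment is shown later, in [mulw_maxcanc]. *)
Definition push a s :=
  if s is b :: s' then if b == bar a then s' else a :: s else [:: a].
Definition mulw s t := foldr push t s.
Definition invw s := rev (map bar s).

Variable r : nat.
Implicit Types s t u : seq nat.

Lemma red_cons a s : red r (a :: s) -> alpha r a /\ red r s.
Proof.
by rewrite /red /= => /andP[/andP[-> ->]] /path_sorted ->.
Qed.

Lemma red_push a s : alpha r a -> red r s -> red r (push a s).
Proof.
case: s => [|b s] ra; first by rewrite /red /= ra.
rewrite /=; case: eqP => [_ /red_cons[] //|/eqP ab]; rewrite /red /=.
by rewrite ra => /andP[/andP[-> ->] ->] /=; rewrite andbT.
Qed.

Lemma pushK a s : red r s -> push (bar a) (push a s) = s.
Proof.
case: s => [|b s]; first by rewrite /= barK eqxx.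
rewrite /=; case: eqP => [->|ab] /=; last by rewrite barK eqxx.
by case: s => //= c s /andP[_] /= /andP[/negPf->].
Qed.

Lemma red_mulw s t : all (alpha r) s -> red r t -> red r (mulw s t).
Proof. by elim: s => //= a s IHs /andP[ra rs] rt; rewrite red_push ?IHs. Qed.

(** Letters act on reduced words by permutations, [push (bar a)] undoing [push a], so a cancellation
    inside the left factor does not change the product. *)
Lemma mulw_push a s t : all (alpha r) s -> red r t ->
  mulw (push a s) t = push a (mulw s t).
Proof.
case: s => //= b s /andP[rb rs] rt; case: eqP => //= ->.
by rewrite -[in RHS](barK a) barK -{1}(barK a) pushK ?red_mulw.
Qed.

Lemma mulwA s t u : all (alpha r) s -> red r t -> red r u ->
  mulw (mulw s t) u = mulw s (mulw t u).
Proof.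
move=> + rt ru; elim: s => //= a s IHs /andP[ra rs].
by rewrite mulw_push ?IHs //; case/andP: (red_mulw rs rt).
Qed.

Lemma all_invw s : all (alpha r) (invw s) = all (alpha r) s.
Proof.
by rewrite all_rev all_map; apply: eq_all => a; rewrite /= alpha_bar.
Qed.

Lemma size_invw s : size (invw s) = size s.
Proof. by rewrite size_rev size_map. Qed.

Lemma invwK : involutive invw.
Proof. by move=> s; rewrite /invw map_rev revK mapK //; exact: barK. Qed.

Lemma red_invw s : red r s -> red r (invw s).
Proof.
case/andP=> rs ss; rewrite /red all_invw rs rev_sorted sorted_map.
apply: sub_sorted ss => a b; rewrite /noncancel /= barK eq_sym.
by apply: contraNN => /eqP->.
Qed.

Lemma mulwVw s : mulw (invw s) s = [::].
Proof.
elim: s => // a s IHs.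
by rewrite /invw map_cons rev_cons -cats1 /mulw foldr_cat /= barK eqxx.
Qed.

Lemma mulw_cat s t : sorted noncancel (s ++ t) -> mulw s t = s ++ t.
Proof.
elim: s => //= a s IHs ast; rewrite (IHs (path_sorted ast)).
by case: (s ++ t) ast => //= b u /andP[/negPf->].
Qed.

Lemma mulw1 s : red r s -> mulw s [::] = s.
Proof. by case/andP=> _ ss; rewrite mulw_cat ?cats0. Qed.

Lemma mulw_cancel s d t : mulw (s ++ d) (invw d ++ t) = mulw s t.
Proof.
rewrite /mulw foldr_cat; congr foldr.
elim: d t => // a d IHd t.
by rewrite /invw map_cons rev_cons -cats1 -catA /= IHd /= eqxx.
Qed.

Lemma size_mulw s t : size (mulw s t) <= size s + size t.
Proof.
elim: s => //= a s; case: (mulw s t) => //= b u.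
by rewrite addSn; case: ifP => _ /=; lia.
Qed.

Lemma sorted_rcons_cons (e : rel nat) s a b t :
  sorted e (rcons s a ++ b :: t) =
  [&& sorted e (rcons s a), e a b & sorted e (b :: t)].
Proof.
rewrite sorted_cat_cons andbA; congr (_ && _).
case: s => [|c s] /=; rewrite ?andbT // [LHS]rcons_path.
by rewrite last_rcons.
Qed.

Lemma not_sorted_cat s t : red r s -> red r t ->
  ~~ sorted noncancel (s ++ t) ->
  exists s' a t', s = rcons s' a /\ t = bar a :: t'.
Proof.
case/lastP: s => [|s a]; first by move=> _ /andP[_ ->].
case: t => [|b t] /andP[_ ss]; first by rewrite cats0 ss.
case/andP=> _ st; rewrite sorted_rcons_cons ss st andbT /= negbK => /eqP->.
by exists s, a, t.
Qed.

Lemma size_mulw_lt s t : red r s -> red r t ->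
  ~~ sorted noncancel (s ++ t) -> size (mulw s t) < size s + size t.
Proof.
move=> rs rt /not_sorted_cat -/(_ rs rt)[s' [a [t' [-> ->]]]].
rewrite -cats1 -[bar a :: t']/(invw [:: a] ++ t') mulw_cancel.
by apply: leq_ltn_trans (size_mulw _ _) _; rewrite !size_cat /=; lia.
Qed.

Lemma sorted_cat3 s h t : h != [::] ->
  sorted noncancel (s ++ h ++ t) =
  sorted noncancel (s ++ h) && sorted noncancel (h ++ t).
Proof.
case/lastP: s => [|s a].
  move=> _; rewrite !cat0s.
  by have [/cat_sorted2[-> _]|_] := boolP (sorted _ (h ++ t)); rewrite ?andbF.
case: h => // b h _; rewrite !cat_cons !sorted_rcons_cons.
rewrite -cat_cons.
have [/cat_sorted2[-> _]|_] := boolP (sorted _ (_ ++ t)); last by rewrite !andbF.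
by rewrite !andbT.
Qed.

(** Being reduced is a condition on adjacent letters. The only junctions in the conclusion are
    [c|h], [h|h] and [h|d], and each of them already occurs in one of the two hypotheses. *)
Lemma sorted_conj_pow c h d m n : h != [::] -> 0 < m ->
  sorted noncancel (c ++ wpow h m ++ d) -> sorted noncancel (wpow h m ++ wpow h m) ->
  sorted noncancel (c ++ wpow h n.+1 ++ d).
Proof.
case: m => // m h0 _ cd hh.
have ch : sorted noncancel (c ++ h).
  by move: cd; rewrite wpowS -catA catA => /cat_sorted2[].
have hd : sorted noncancel (h ++ d).
  by move: cd; rewrite wpowSr -catA catA => /cat_sorted2[].
have {}hh : sorted noncancel (h ++ h).
  move: hh; rewrite {1}wpowSr wpowS -catA.
  by move=> /cat_sorted2[_]; rewrite catA => /cat_sorted2[].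
elim: n c ch {cd} => [|n IHn] c ch; first by rewrite /wpow /= cats0 sorted_cat3 ?ch.
by rewrite wpowS -catA catA IHn // -catA sorted_cat3 // ch.
Qed.

(** Induction on the length: if [s ++ s] is not reduced, then [s] starts with the inverse of its
    last letter, and both end letters move into the conjugator [c]. *)
Lemma cyclic_reduction s : red r s -> s != [::] ->
  exists c w, [/\ s = c ++ w ++ invw c, w != [::] & sorted noncancel (w ++ w)].
Proof.
have [n] := ubnP (size s); elim: n s => // n IHn s; rewrite ltnS => le_sn rs s0.
have [ss|nss] := boolP (sorted noncancel (s ++ s)).
  by exists [::], s; rewrite cats0.
have [s' [a [t' [s_rcons s_cons]]]] := not_sorted_cat rs rs nss.
have ra : alpha r a by case/andP: rs; rewrite s_rcons all_rcons => /andP[].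
(* The two end letters are distinct positions, since no letter is its own inverse. *)
case: s' s_rcons => [|b u] s_rcons.
  move: s_cons; rewrite s_rcons => -[a_bar _].
  by move: (noncancelaa ra); rewrite /noncancel -a_bar eqxx.
have b_def : b = bar a by move: s_cons; rewrite s_rcons => -[].
rewrite {b}b_def in s_rcons.
have ru : red r u.
  case/andP: rs; rewrite /red s_rcons -cats1 /= all_cat => /and3P[_ -> _].
  by move=> /path_sorted /cat_sorted2[->].
(* With an empty middle part, [s] would be [bar a] followed by [a], which is not reduced. *)
have u0 : u != [::].
  apply: contraTneq rs => u0.
  by rewrite s_rcons u0 /red /= /noncancel barK eqxx /= !andbF.
have [|c [w [u_def w0 ww]]] := IHn u _ ru u0.
  by move: le_sn; rewrite s_rcons /= size_rcons => /ltnW.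
exists (bar a :: c), w; split=> //.
by rewrite s_rcons u_def /invw map_cons rev_cons barK /= -!rcons_cat.
Qed.

End ReducedWords.

(** * The free group of reduced words and its centralizers *)

Record rword r := RWord { rwordval :> seq nat; rwordP : red r rwordval }.

HB.instance Definition _ r := [isSub for @rwordval r].
HB.instance Definition _ r := [Choice of rword r by <:].

Section FreeGroup.

Variable r : nat.
Implicit Types x y z : rword r.

Lemma all_rword x : all (alpha r) x. Proof. by case/andP: (rwordP x). Qed.

Definition rone : rword r := RWord (isT : red r [::]).
Definition rinv x : rword r := RWord (red_invw (rwordP x)).
Definition rmul x y : rword r := RWord (red_mulw (all_rword x) (rwordP y)).

Lemma rmulA : associative rmul.
Proof.
move=> x y z; apply: val_inj.
by rewrite /= (mulwA (all_rword x) (rwordP y) (rwordP z)).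
Qed.
Lemma rmul1w : left_id rone rmul. Proof. by move=> x; apply: val_inj. Qed.
Lemma rmulw1 : right_id rone rmul.
Proof. by move=> x; apply: val_inj; rewrite /= (mulw1 (rwordP x)). Qed.
Lemma rmulVw : left_inverse rone rinv rmul.
Proof. by move=> x; apply: val_inj; rewrite /= mulwVw. Qed.
Lemma rmulwV : right_inverse rone rinv rmul.
Proof. by move=> x; apply: val_inj; rewrite /= -{1}[rwordval x]invwK mulwVw. Qed.

HB.instance Definition _ := isGroup.Build (rword r) rmulA rmul1w rmulw1 rmulVw rmulwV.

Local Open Scope group_scope.

Lemma val_rmul x y : x * y = mulw x y :> seq nat. Proof. by []. Qed.
Lemma val_rinv x : x^-1 = invw x :> seq nat. Proof. by []. Qed.

Lemma rword_eq1 x : (x == 1) = (rwordval x == [::]).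
Proof. by rewrite -val_eqE. Qed.

Lemma val_rmul_cat x y : sorted noncancel (rwordval x ++ y) ->
  x * y = x ++ y :> seq nat.
Proof. exact: mulw_cat. Qed.

(** If [y ++ w] is reduced, then [w * y = y * w] has full length, so [w ++ y] is reduced too and
    both products are concatenations. Otherwise both products cancel: [y] ends with the inverse of
    the first letter of [w] and starts with the inverse of its last letter. The junction of [y^-1]
    with [w] is then that of [w] with [w], and the first case applies to [y^-1]. *)
Lemma commute_cyclic w y : sorted noncancel (rwordval w ++ w) -> w != 1 ->
  commute w y ->
  w ++ y = y ++ w :> seq nat \/ w ++ y^-1 = y^-1 ++ w :> seq nat.
Proof.
have commute_cat z : sorted noncancel (rwordval z ++ w) -> commute w z ->
  w ++ z = z ++ w :> seq nat.
  move=> zw wz; have valzw := val_rmul_cat zw.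
  have valwz : w * z = z ++ w :> seq nat by rewrite -valzw wz.
  have [/val_rmul_cat <- //|] := boolP (sorted noncancel (rwordval w ++ z)).
  move/(size_mulw_lt (rwordP w) (rwordP z)).
  by rewrite -val_rmul valwz size_cat addnC ltnn.
move=> ww w1 wy.
have [yw|nyw] := boolP (sorted noncancel (rwordval y ++ w)).
  by left; exact: commute_cat.
right; apply: commute_cat; last exact: commuteV.
have [wy'|nwy] := boolP (sorted noncancel (rwordval w ++ y)).
  have := size_mulw_lt (rwordP y) (rwordP w) nyw.
  by rewrite -val_rmul -wy val_rmul_cat // size_cat addnC ltnn.
have [y' [a [w' [y_def w_def]]]] := not_sorted_cat (rwordP y) (rwordP w) nyw.
have [w'' [b [y'' [w_def' y_def']]]] := not_sorted_cat (rwordP w) (rwordP y) nwy.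
have := rwordP (y^-1); rewrite val_rinv y_def' /invw map_cons barK rev_cons.
move=> /andP[_ syV]; have /andP[_ sw] := rwordP w.
rewrite w_def sorted_rcons_cons syV -w_def sw andbT /=.
by move: ww; rewrite {1}w_def' w_def sorted_rcons_cons => /and3P[].
Qed.

Lemma val_expgn x n : sorted noncancel (wpow (rwordval x) n) ->
  x ^+ n = wpow (rwordval x) n :> seq nat.
Proof.
elim: n => [|n IHn] // sxn; rewrite expgS wpowS -IHn ?val_rmul_cat ?IHn //;
  by case/cat_sorted2: sxn.
Qed.

Lemma sub_red (s t u : seq nat) : red r (s ++ t ++ u) -> red r t.
Proof.
case/andP; rewrite !all_cat /red => /and3P[_ -> _].
by move=> /cat_sorted2[_] /cat_sorted2[].
Qed.

(** Write [x] as [c w c^-1] with [w] cyclically reduced and a power of the word [h] of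
    [free_monoid_commute]; conjugation by [c] reduces the question to the elements commuting with
    [w]. The generator is [k = c h c^-1], with [m] twice the length of [c] and [l] the length of
    [h]. The length formula needs a positive exponent, as the two copies of [c] cancel in [k ^+ 0].
    Quotients of powers with natural exponents avoid integers, which the language of arithmetic does
    not have. *)
Theorem centralizer_cyclic x : x != 1 -> exists k m l,
  [/\ 0 < l, forall n, size (k ^+ n.+1 : rword r) = m + n.+1 * l &
      forall y, commute x y <-> exists p q, y = k ^+ p / k ^+ q].
Proof.
rewrite rword_eq1 => x1; have rx := rwordP x.
have [c [w [x_def w0 ww]]] := cyclic_reduction rx x1.
rewrite x_def in rx.
have rc : red r c := @sub_red [::] _ _ rx.
have rw : red r w := sub_red rx.
have [h h0 comm_h] := free_monoid_commute w0.
have [m w_def] : exists m, w = wpow h m by apply/comm_h.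
have m0 : 0 < m by case: m w_def => // w_nil; rewrite w_nil in w0.
have rh : red r h.
  case: m w_def m0 => // m; rewrite wpowS => w_def _.
  by rewrite w_def in rw; exact: (@sub_red [::] _ _ rw).
pose C := RWord rc; pose H := RWord rh; pose W := RWord rw.
(* The exponent [m] occurs in the reduced word [x] itself; [sorted_conj_pow] carries this over to
   every positive exponent. *)
have sorted_pow n : sorted noncancel (c ++ wpow h n.+1 ++ invw c).
  by apply: (@sorted_conj_pow c h _ m) => //; rewrite -w_def //; case/andP: rx.
have val_H n : H ^+ n = wpow h n :> seq nat.
  apply: val_expgn; case: n => // n.
  by have /cat_sorted2[_ /cat_sorted2[]] := sorted_pow n.
have W_def : W = H ^+ m by apply: val_inj; rewrite /= val_H.
have val_k n : C * (H ^+ n.+1 / C) = c ++ wpow h n.+1 ++ invw c :> seq nat.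
  have HC : H ^+ n.+1 / C = wpow h n.+1 ++ invw c :> seq nat.
    by rewrite val_rmul_cat val_H //; have /cat_sorted2[] := sorted_pow n.
  by rewrite val_rmul_cat HC.
have kE n : (H ^ C^-1) ^+ n = H ^+ n ^ C^-1 by rewrite conjXg.
have x_conj : x = H ^+ m ^ C^-1.
  apply: val_inj; rewrite conjgE invgK -(prednK m0).
  by apply/esym/(etrans (val_k _)); rewrite prednK // -w_def.
exists (H ^ C^-1), (size c + size c), (size h); split=> [|n|y].
- by rewrite lt0n size_eq0.
- rewrite kE conjgE invgK val_k !size_cat size_invw size_wpow.
  by rewrite addnCA addnC addnA.
split=> [xy|[p [q ->]]]; last first.
  rewrite x_conj -kE; apply: commuteM; last apply: commuteV.
    by apply: commuteX; apply: commute_sym; apply: commuteX.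
  by apply: commuteX; apply: commute_sym; apply: commuteX.
have wy : commute W (y ^ C).
  rewrite W_def /commute -[H ^+ m](conjgKV C) -!conjMg; congr (_ ^ _).
  by rewrite -x_conj.
have W1 : W != 1 by rewrite rword_eq1.
have pow_of z : w ++ z = z ++ w :> seq nat -> exists n, rwordval z = wpow h n.
  by move=> wz; apply/comm_h.
have [/pow_of[n yn]|/pow_of[n yn]] := @commute_cyclic W _ ww W1 wy.
  exists n, 0; rewrite invg1 mulg1 kE.
  rewrite -[LHS](conjgK C); congr (_ ^ _); apply: val_inj.
  exact: etrans yn (esym (val_H n)).
exists 0, n; rewrite mul1g kE -conjVg -[LHS](conjgK C); congr (_ ^ _).
rewrite -[LHS]invgK; congr (_^-1).
by apply: val_inj; apply: etrans yn (esym (val_H n)).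
Qed.

End FreeGroup.
(** * Definability and transfer *)

Section Definability.

(** Predicates are given uniformly in all structures, and one formula must define them in each.
    Sentences can then be stated as ordinary propositions about [M]. *)
Definition pfam n := forall M : arith, ('I_n -> M) -> Prop.
Definition tfam n := forall M : arith, ('I_n -> M) -> M.

Definition definable n (P : pfam n) :=
  exists f : formula n, forall (M : arith) (v : 'I_n -> M), sat f v <-> P M v.
Definition term_definable n (x : tfam n) :=
  exists t : term n, forall (M : arith) (v : 'I_n -> M), eval v t = x M v.

Lemma scons0 (M : arith) n (x : M) (v : 'I_n -> M) : scons x v ord0 = x.
Proof. by rewrite /scons unlift_none. Qed.

Lemma scons_lift (M : arith) n (x : M) (v : 'I_n -> M) :
  (fun i => scons x v (lift ord0 i)) = v.
Proof. by apply: functional_extensionality => i; rewrite /scons liftK. Qed.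

Lemma tdef_var n i : term_definable (fun M (v : 'I_n -> M) => v i).
Proof. by exists (Var i). Qed.
Lemma tdef_zero n : term_definable (fun M (_ : 'I_n -> M) => azero M).
Proof. by exists (Zero n). Qed.
Lemma tdef_one n : term_definable (fun M (_ : 'I_n -> M) => aone M).
Proof. by exists (One n). Qed.
Lemma tdef_add n (x y : tfam n) : term_definable x -> term_definable y ->
  term_definable (fun M v => aadd (x M v) (y M v)).
Proof. by case=> [t tE] [u uE]; exists (Add t u) => M v /=; rewrite tE uE. Qed.
Lemma tdef_mul n (x y : tfam n) : term_definable x -> term_definable y ->
  term_definable (fun M v => amul (x M v) (y M v)).
Proof. by case=> [t tE] [u uE]; exists (Mul t u) => M v /=; rewrite tE uE. Qed.
Lemma tdef_eval n k (t : term k) (s : 'I_k -> tfam n) :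
  (forall i, term_definable (s i)) ->
  term_definable (fun M v => eval (fun i => s i M v) t).
Proof.
move=> ds; elim: t => [i|||t IHt u IHu|t IHt u IHu] //=.
- exact: tdef_zero.
- exact: tdef_one.
- exact: tdef_add.
- exact: tdef_mul.
Qed.

Lemma tdef_rename n m (s : 'I_n -> 'I_m) (x : tfam n) : term_definable x ->
  term_definable (fun M w => x M (fun i => w (s i))).
Proof.
case=> t tE; have [u uE] := tdef_eval t (fun i => tdef_var (s i)).
by exists u => M w; rewrite uE tE.
Qed.

Lemma def_eq n (x y : tfam n) : term_definable x -> term_definable y ->
  definable (fun M v => x M v = y M v).
Proof. by case=> [t tE] [u uE]; exists (Eq t u) => M v /=; rewrite tE uE. Qed.
Lemma def_not n (P : pfam n) : definable P -> definable (fun M v => ~ P M v).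
Proof. by case=> f fE; exists (Neg f) => M v /=; rewrite fE. Qed.
Lemma def_and n (P Q : pfam n) : definable P -> definable Q ->
  definable (fun M v => P M v /\ Q M v).
Proof. by case=> f fE [g gE]; exists (And f g) => M v /=; rewrite fE gE. Qed.
Lemma def_or n (P Q : pfam n) : definable P -> definable Q ->
  definable (fun M v => P M v \/ Q M v).
Proof. by case=> f fE [g gE]; exists (Or f g) => M v /=; rewrite fE gE. Qed.
Lemma def_imp n (P Q : pfam n) : definable P -> definable Q ->
  definable (fun M v => P M v -> Q M v).
Proof. by case=> f fE [g gE]; exists (Imp f g) => M v /=; rewrite fE gE. Qed.
Lemma def_iff n (P Q : pfam n) : definable P -> definable Q ->
  definable (fun M v => P M v <-> Q M v).
Proof. by move=> dP dQ; apply: def_and; apply: def_imp. Qed.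

Lemma def_all n (P : forall M : arith, M -> ('I_n -> M) -> Prop) :
  definable (fun M (w : 'I_n.+1 -> M) => P M (w ord0) (fun i => w (lift ord0 i))) ->
  definable (fun M v => forall x : M, P M x v).
Proof.
case=> f fE; exists (All f) => M v; split=> /= Pv x; have := Pv x.
  by rewrite fE scons0 scons_lift.
by rewrite fE scons0 scons_lift.
Qed.

Lemma def_ex n (P : forall M : arith, M -> ('I_n -> M) -> Prop) :
  definable (fun M (w : 'I_n.+1 -> M) => P M (w ord0) (fun i => w (lift ord0 i))) ->
  definable (fun M v => exists x : M, P M x v).
Proof.
case=> f fE; exists (Ex f) => M v; split=> [[x /fE Px]|[x Px]]; exists x.
  by move: Px; rewrite scons0 scons_lift.
by apply/fE; rewrite scons0 scons_lift.
Qed.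

Lemma tdef_scons n k (s : 'I_k -> tfam n) :
  (forall i, term_definable (s i)) ->
  forall i, term_definable (fun M (w : 'I_n.+1 -> M) =>
    scons (w ord0) (fun j => s j M (fun a => w (lift ord0 a))) i).
Proof.
move=> ds i; rewrite /scons; case: (unlift ord0 i) => [j|]; last exact: tdef_var.
exact: (tdef_rename _ (ds j)).
Qed.

(** Substitution of terms into a formula, needed because [T] and [L] are arbitrary given formulas.
    Under a quantifier the substitution is extended by [tdef_scons]. *)
Lemma def_sat n k (f : formula k) (s : 'I_k -> tfam n) :
  (forall i, term_definable (s i)) ->
  definable (fun M v => sat f (fun i => s i M v)).
Proof.
move: n s; elim: f => {k} [k t u|k f IHf|k f IHf g IHg|k f IHf g IHg
  |k f IHf g IHg|k f IHf|k f IHf] n s ds /=.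
- by apply: def_eq; apply: tdef_eval.
- by apply: def_not; apply: IHf.
- by apply: def_and; [apply: IHf|apply: IHg].
- by apply: def_or; [apply: IHf|apply: IHg].
- by apply: def_imp; [apply: IHf|apply: IHg].
- by apply: def_all; apply: (IHf _ (fun i M w => _) (tdef_scons ds)).
by apply: def_ex; apply: (IHf _ (fun i M w => _) (tdef_scons ds)).
Qed.

Lemma def_T n (T : formula 3) (x y z : tfam n) :
  term_definable x -> term_definable y -> term_definable z ->
  definable (fun M v => satT T (x M v) (y M v) (z M v)).
Proof.
move=> dx dy dz.
case: (@def_sat n _ T (fun i => tnth [tuple x; y; z] i)).
  by move=> i; rewrite (tnth_nth x); case: i => -[|[|[|]]].
move=> f fE; exists f => M v; rewrite fE /satT.
suff -> : (fun i => tnth [tuple x; y; z] i M v) = tnth [tuple x M v; y M v; z M v] by [].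
apply: functional_extensionality => i.
by rewrite (tnth_nth x) (tnth_nth (x M v)); case: i => -[|[|[|]]].
Qed.

Lemma def_L n (L : formula 2) (x y : tfam n) :
  term_definable x -> term_definable y ->
  definable (fun M v => satL L (x M v) (y M v)).
Proof.
move=> dx dy.
case: (@def_sat n _ L (fun i => tnth [tuple x; y] i)).
  by move=> i; rewrite (tnth_nth x); case: i => -[|[|]].
move=> f fE; exists f => M v; rewrite fE /satL.
suff -> : (fun i => tnth [tuple x; y] i M v) = tnth [tuple x M v; y M v] by [].
apply: functional_extensionality => i.
by rewrite (tnth_nth x) (tnth_nth (x M v)); case: i => -[|[|]].
Qed.

Lemma transfer (S : arith -> Prop) (M1 M2 : arith) :
  definable (fun M (_ : 'I_0 -> M) => S M) -> elem_equiv M1 M2 -> S M2 -> S M1.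
Proof.
by case=> f fE M12 S2; apply/(fE M1 (tnth [tuple])); apply/M12; apply/fE.
Qed.

End Definability.

(** * Reduced words and their product as predicates on codes *)

Section Predicates.

Variables (T : formula 3) (L : formula 2) (r : nat).

Definition numeral (M : arith) k : M := iter k (aadd (aone M)) (azero M).

Section InModel.
Variable M : arith.
Implicit Types n m p l a b : M.

Definition code_comp n a i := satT T n a i.
Definition code_len n k := satL L n k.
(* [zcode (- (i + 1))] and [zcode (i + 1)] are [2i + 1] and [2i + 2]. *)
Definition code_opp a b := exists i,
  (a = aadd (aadd i i) (aone M) /\ b = aadd a (aone M)) \/
  (b = aadd (aadd i i) (aone M) /\ a = aadd b (aone M)).
(** Under [zcode], the integers of absolute value between 1 and [r] are exactly those with codes
    between 1 and [r.*2]. *)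
Definition code_red n :=
  (forall a i, code_comp n a i -> ale (aone M) a /\ ale a (numeral M r.*2)) /\
  (forall a b i, code_comp n a i -> code_comp n b (aadd i (aone M)) -> ~ code_opp a b).
Definition code_cancels n m l := exists k k',
  [/\ code_len n k, code_len m k', ale l k, ale l k' &
      forall i j, in1 l j -> aadd i j = aadd k (aone M) ->
        forall a b, code_comp n a i -> code_comp m b j -> code_opp a b].
Definition code_mul n m p := exists l c d,
  [/\ code_cancels n m l /\ (forall l', code_cancels n m l' -> ale l' l),
      code_len n (aadd c l) /\ code_len m (aadd l d), code_len p (aadd c d),
      forall i, in1 c i -> forall a, code_comp p a i -> code_comp n a i &
      forall i, in1 d i -> forall a, code_comp p a (aadd c i) -> code_comp m a (aadd l i)].
End InModel.

End Predicates.

Lemma def_and3 n (P Q R : pfam n) : definable P -> definable Q -> definable R ->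
  definable (fun M v => [/\ P M v, Q M v & R M v]).
Proof.
move=> dP dQ dR; case: (def_and dP (def_and dQ dR)) => f fE; exists f => M v.
by rewrite fE; split=> [[? []]|[]].
Qed.
Lemma def_and4 n (P Q R S : pfam n) : definable P -> definable Q -> definable R ->
  definable S -> definable (fun M v => [/\ P M v, Q M v, R M v & S M v]).
Proof.
move=> dP dQ dR dS; case: (def_and dP (def_and3 dQ dR dS)) => f fE.
by exists f => M v; rewrite fE; split=> [[? []]|[]].
Qed.
Lemma def_and5 n (P Q R S U : pfam n) : definable P -> definable Q ->
  definable R -> definable S -> definable U ->
  definable (fun M v => [/\ P M v, Q M v, R M v, S M v & U M v]).
Proof.
move=> dP dQ dR dS dU; case: (def_and dP (def_and4 dQ dR dS dU)) => f fE.
by exists f => M v; rewrite fE; split=> [[? []]|[]].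
Qed.

Lemma tdef_numeral n k : term_definable (fun M (_ : 'I_n -> M) => numeral M k).
Proof.
elim: k => [|k IHk]; first exact: tdef_zero.
by apply: tdef_add IHk; apply: tdef_one.
Qed.

Ltac tdef := cbv beta; lazymatch goal with
  | |- term_definable (fun M w => aadd _ _) => apply: tdef_add; tdef
  | |- term_definable (fun M w => amul _ _) => apply: tdef_mul; tdef
  | |- term_definable (fun M w => azero _) => apply: tdef_zero
  | |- term_definable (fun M w => aone _) => apply: tdef_one
  | |- term_definable (fun M w => w _) => apply: tdef_var
  | |- term_definable (fun M w => numeral _ _) => apply: tdef_numeral
  | H : term_definable ?x |- term_definable (fun M w => ?x _ _) =>
     apply: (tdef_rename _ H)
  | _ => assumption
  end.

Lemma def_le n (x y : tfam n) : term_definable x -> term_definable y ->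
  definable (fun M v => ale (x M v) (y M v)).
Proof. by move=> dx dy; apply: def_ex; apply: def_eq; tdef. Qed.

Ltac def tac := cbv beta; lazymatch goal with
  | |- definable (fun M w => _ = _) => apply: def_eq; tdef
  | |- definable (fun M w => ale _ _) => apply: def_le; tdef
  | |- definable (fun M w => satT _ _ _ _) => apply: def_T; tdef
  | |- definable (fun M w => satL _ _ _) => apply: def_L; tdef
  | |- definable (fun M w => _ /\ _) => apply: def_and; def tac
  | |- definable (fun M w => [/\ _, _ & _]) => apply: def_and3; def tac
  | |- definable (fun M w => [/\ _, _, _ & _]) => apply: def_and4; def tac
  | |- definable (fun M w => [/\ _, _, _, _ & _]) => apply: def_and5; def tac
  | |- definable (fun M w => _ \/ _) => apply: def_or; def tac
  | |- definable (fun M w => _ <-> _) => apply: def_iff; def tac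
  | |- definable (fun M w => ~ _) => apply: def_not; def tac
  | |- definable (fun M w => ex _) => apply: def_ex; def tac
  | |- definable (fun M w => forall _, _) =>
      first [apply: def_imp | apply: def_all]; def tac
  | _ => tac
  end.

Lemma def_code_mul n T L (x y z : tfam n) :
  term_definable x -> term_definable y -> term_definable z ->
  definable (fun M v => code_mul T L (x M v) (y M v) (z M v)).
Proof.
move=> dx dy dz; rewrite /code_mul /code_cancels /code_opp /in1 /code_len /code_comp.
def idtac.
Qed.

Lemma def_code_red n T r (x : tfam n) :
  term_definable x -> definable (fun M v => code_red T r (x M v)).
Proof. move=> dx; rewrite /code_red /code_opp /code_comp; def idtac. Qed.

(** * Truth in the standard model *)

Section StandardModel.

Variables (r : nat) (e : nat -> seq nat) (T : formula 3) (L : formula 2).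
Hypotheses (T_def : defines_components e T) (L_def : defines_length e L).

Lemma ale_nat (x y : nat) : ale (M := natA) x y <-> x <= y.
Proof. by split=> [[z <-]|le_xy]; [exact: leq_addr | exists (y - x); exact: subnKC]. Qed.

Lemma in1_nat (k i : nat) : in1 (M := natA) k i <-> 0 < i <= k.
Proof. by rewrite /in1 !ale_nat; split=> /andP. Qed.

Lemma numeral_nat (k : nat) : numeral natA k = k.
Proof. by rewrite /numeral; elim: k => //= k ->. Qed.

Lemma len_natE (n k : nat) : code_len L (M := natA) n k <-> size (e n) = k.
Proof. exact: L_def. Qed.

Lemma comp_natE (n a i : nat) : code_comp T (M := natA) n a i <->
  0 < i <= size (e n) /\ nth 0 (e n) i.-1 = a.
Proof. by rewrite /code_comp T_def; split=> [[-> ->]|[/andP[]]]. Qed.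

Lemma comp_nth (n i : nat) : i < size (e n) ->
  code_comp T (M := natA) n (nth 0 (e n) i) i.+1.
Proof. by move=> lt_i; apply/comp_natE. Qed.

Lemma opp_natE (a b : nat) : code_opp (M := natA) a b <-> 0 < a /\ b = bar a.
Proof.
rewrite /code_opp /bar; split=> [[i]|[a0 ->]] /=.
  by rewrite /=; case=> -[-> ->]; case: ifP; lia.
case: ifP => a_odd; [exists a./2; left | exists a.-1./2; right]; lia.
Qed.

Lemma red_natE (n : nat) : code_red T r (M := natA) n <-> red r (e n).
Proof.
rewrite /code_red /red; split=> [[An Sn]|/andP[/all_nthP An /sortedP Sn]].
  apply/andP; split.
    apply/(all_nthP 0) => i lt_i.
    have [] := An _ _ (comp_nth lt_i).
    by rewrite !ale_nat numeral_nat /alpha => -> ->.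
  apply/(sortedP 0) => i lt_i; apply/negP => /eqP bar_i.
  have [/ale_nat a_gt0 _] := An _ _ (comp_nth (ltnW lt_i)).
  apply: (Sn _ _ _ (comp_nth (ltnW lt_i))); first by rewrite /= addn1; exact: comp_nth.
  exact/opp_natE.
split=> [a i /comp_natE[/andP[i0 le_i] <-]|a b i /comp_natE[/andP[i0 le_i] <-]].
  rewrite !ale_nat numeral_nat; apply/andP.
  by apply: An; rewrite prednK.
move=> /comp_natE[] /=; rewrite addn1 /= => lt_i <- /opp_natE[_ /eqP].
by apply/negP; have := Sn 0 i.-1; rewrite prednK //; apply.
Qed.

Definition canc (s t : seq nat) l :=
  [&& l <= size s, l <= size t & take l t == invw (drop (size s - l) s)].

Lemma cancP (s t : seq nat) l : l <= size s -> l <= size t ->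
  reflect (forall j, j < l -> nth 0 t j = bar (nth 0 s (size s - j.+1)))
    (take l t == invw (drop (size s - l) s)).
Proof.
move=> ls lt; set d := drop _ _; have sz_d : size d = l by rewrite size_drop subKn.
have nth_d j : j < l -> nth 0 (invw d) j = bar (nth 0 s (size s - j.+1)).
  move=> lt_j; rewrite nth_rev size_map sz_d // (nth_map 0) ?sz_d; last by lia.
  by rewrite nth_drop; congr (bar (nth _ _ _)); lia.
apply: (iffP eqP) => [td j lt_j|H]; first by rewrite -nth_d // -td nth_take.
apply: (@eq_from_nth _ 0) => [|j]; first by rewrite size_takel // size_invw.
by rewrite size_takel // => lt_j; rewrite nth_take // H // nth_d.
Qed.

Lemma cancels_natE (n m l : nat) : red r (e n) ->
  code_cancels T L (M := natA) n m l <-> canc (e n) (e m) l.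
Proof.
move=> /andP[/(all_nthP 0) rn _]; rewrite /code_cancels /canc; split.
  move=> [k [k' [/len_natE <- /len_natE <- /ale_nat ls /ale_nat lt H]]].
  rewrite ls lt /=; apply/cancP => // j lt_j.
  have lt_i : size (e n) - j.+1 < size (e n) by lia.
  have lt_jm : j < size (e m) by lia.
  have j_in : in1 (M := natA) l j.+1 by apply/in1_nat.
  (* The predicates count positions from 1 and [nth] counts from 0, so both indices are shifted by
     one. *)
  have ij : aadd (a := natA) (size (e n) - j.+1).+1 j.+1 =
      aadd (a := natA) (size (e n)) (aone natA).
    by rewrite /=; lia.
  by have /opp_natE[] := H _ _ j_in ij _ _ (comp_nth lt_i) (comp_nth lt_jm).
case/and3P=> ls lt /(cancP ls lt) H; exists (size (e n)), (size (e m)).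
split; try exact/len_natE; try exact/ale_nat.
move=> /= i j /in1_nat j_in ij a b /comp_natE[i_in <-] /comp_natE[_ <-].
apply/opp_natE; split.
  (* Positivity has to come from reducedness: [bar 0 = 0], but 0 is not the code of a letter and
     [code_opp] excludes it. *)
  have /rn : i.-1 < size (e n) by lia.
  by case/andP.
by rewrite H; [congr (bar (nth _ _ _)); lia | lia].
Qed.

Lemma mulw_canc (s t : seq nat) l : canc s t l ->
  mulw s t = mulw (take (size s - l) s) (drop l t).
Proof.
case/and3P=> ls lt /eqP st; rewrite -{1}[s](cat_take_drop (size s - l)).
by rewrite -{1}[t](cat_take_drop l) st mulw_cancel.
Qed.

(** What remains after removing a maximal cancelling segment is reduced as it stands: a cancellation
    at the new junction would extend the segment to length [l.+1]. *)
Lemma mulw_maxcanc (s t : seq nat) l : red r s -> red r t ->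
  canc s t l -> (forall l', canc s t l' -> l' <= l) ->
  mulw s t = take (size s - l) s ++ drop l t.
Proof.
move=> rs rt st max_l; have /and3P[ls lt /(cancP ls lt) H] := st.
rewrite (mulw_canc st).
have [/mulw_cat//|] := boolP (sorted noncancel (take (size s - l) s ++ drop l t)).
have rs' : red r (take (size s - l) s).
  case/andP: rs; rewrite -{1 2}[s](cat_take_drop (size s - l)) /red all_cat.
  by move=> /andP[-> _] /cat_sorted2[->].
have rt' : red r (drop l t).
  case/andP: rt; rewrite -{1 2}[t](cat_take_drop l) /red all_cat.
  by move=> /andP[_ ->] /cat_sorted2[_ ->].
case/(not_sorted_cat rs' rt') => s' [a [t' [s_def t_def]]].
have := congr1 size s_def; rewrite size_takel ?leq_subr // size_rcons => sz_s.
have := congr1 size t_def; rewrite size_drop /= => sz_t.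
suff /max_l : canc s t l.+1 by rewrite ltnn.
have ls' : l < size s by lia. have lt' : l < size t by lia.
rewrite /canc ls' lt' /=; apply/cancP => // j; rewrite ltnS leq_eqVlt.
case/predU1P=> [->|]; last exact: H.
have -> : nth 0 t l = bar a by rewrite -[l]addn0 -nth_drop t_def.
have -> : size s - l.+1 = size s' by lia.
have -> : nth 0 s (size s') = nth 0 (take (size s - l) s) (size s').
  by rewrite nth_take // sz_s.
by rewrite s_def nth_rcons ltnn eqxx.
Qed.

Lemma maxcanc_ex (s t : seq nat) : exists l,
  canc s t l /\ forall l', canc s t l' -> l' <= l.
Proof.
have ex0 : exists l, canc s t l.
  by exists 0; rewrite /canc /= take0 subn0 drop_size.
have bnd l : canc s t l -> l <= size s by case/and3P.
by case: (ex_maxnP ex0 bnd) => l; exists l.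
Qed.

Lemma mul_natE (n m p : nat) : red r (e n) -> red r (e m) ->
  code_mul T L (M := natA) n m p <-> e p = mulw (e n) (e m).
Proof.
move=> rn rm; split=> [[l [c [d [[/(cancels_natE _ _ rn) cl max_l]]]]]|ep].
  move=> [/len_natE sz_n /len_natE sz_m] /len_natE sz_p Hc Hd.
  rewrite /= in sz_n sz_m sz_p.
  rewrite (mulw_maxcanc rn rm cl); last first.
    by move=> l' /(cancels_natE _ _ rn) /max_l /ale_nat.
  rewrite sz_n addnK; apply: (@eq_from_nth _ 0).
    by rewrite size_cat size_takel ?size_drop ?sz_p ?sz_m; lia.
  move=> i; rewrite sz_p => lt_i; rewrite nth_cat size_takel; last by lia.
  case: ltnP => [lt_ic|le_ci].
    have /in1_nat i_in : 0 < i.+1 <= c by [].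
    have /(Hc _ i_in) /comp_natE[_ <-] : code_comp T (M := natA) p (nth 0 (e p) i) i.+1.
      by apply: comp_nth; rewrite sz_p.
    by rewrite nth_take.
  have /in1_nat i_in : 0 < (i - c).+1 <= d by lia.
  have /(Hd _ i_in) /comp_natE[_] :
      code_comp T (M := natA) p (nth 0 (e p) i) (aadd (a := natA) c (i - c).+1).
    by rewrite /= addnS subnKC //; apply: comp_nth; rewrite sz_p.
  by rewrite /= addnS => <-; rewrite nth_drop.
have [l [cl max_l]] := maxcanc_ex (e n) (e m).
have /and3P[ln lm _] := cl; rewrite (mulw_maxcanc rn rm cl max_l) in ep.
exists l, (size (e n) - l), (size (e m) - l); split.
- split; first exact/cancels_natE.
  by move=> l' /(cancels_natE _ _ rn) /max_l /ale_nat.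
- by split; apply/len_natE; rewrite /= ?subnK ?subnKC.
- by apply/len_natE; rewrite ep size_cat size_takel ?leq_subr // size_drop.
- move=> /= i /in1_nat i_in a /comp_natE[_ <-]; apply/comp_natE.
  rewrite ep nth_cat size_takel ?leq_subr // nth_take ?ifT; lia.
move=> /= i /in1_nat i_in a /comp_natE[_ <-]; apply/comp_natE.
rewrite ep nth_cat size_takel ?leq_subr // nth_drop /= ifF; last by lia.
split; [lia | congr nth; lia].
Qed.

End StandardModel.

(** * The sentences to be transferred *)

Section Sentences.

Variables (T : formula 3) (L : formula 2) (r : nat).

Section InModel.
Variable M : arith.
Local Notation code_len := (@code_len L M).
Local Notation code_comp := (@code_comp T M).
Local Notation code_mul := (@code_mul T L M).
Local Notation code_red := (@code_red T r M).

(** Each code is a function on an initial segment [[1, k]]. The last clause is the first-order form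
    of the injectivity of the enumeration. *)
Definition coding_sentence :=
  (forall n, exists k, code_len n k) /\
  (forall n k k', code_len n k -> code_len n k' -> k = k') /\
  (forall n k a i, code_len n k -> code_comp n a i -> in1 k i) /\
  (forall n a b i, code_comp n a i -> code_comp n b i -> a = b) /\
  (forall n k i, code_len n k -> in1 k i -> exists a, code_comp n a i) /\
  (forall n n' k, code_len n k -> code_len n' k ->
     (forall a i, code_comp n a i -> code_comp n' a i) -> n = n').

Definition code_centralizer g u := code_red u /\
  exists v, [/\ code_red v, code_mul g u v & code_mul u g v].

(* The length determines [u] up to inversion, and [k * u] is longer than [u] only
   for the positive power. *)
Definition code_pos_power g k m l d u :=
  [/\ code_centralizer g u, code_len u (aadd m (amul (aadd d (aone M)) l)) &
      exists v, code_mul k u v /\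
        code_len v (aadd m (amul (aadd (aadd d (aone M)) (aone M)) l))].

(* [u] is the product of the [p]-th power of [k] and the [q]-th power of its
   inverse [k']; the [n.+1]-st powers of [k] and [k'] have length [m + n.+1 * l]. *)
Definition code_power g k k' m l p q u :=
  (p = q /\ code_centralizer g u /\ code_len u (azero M)) \/
  (exists d, p = aadd q (aadd d (aone M)) /\ code_pos_power g k m l d u) \/
  (exists d, q = aadd p (aadd d (aone M)) /\ code_pos_power g k' m l d u).

(** The integers appear as pairs [(p, q)] modulo equality of differences. The four clauses give
    totality, well-definedness together with injectivity, the image, and multiplicativity of the map
    that [code_power] induces on them. *)
Definition centralizer_sentence := forall g, code_red g -> ~ code_len g (azero M) ->
  exists k k' m l,
  [/\ forall p q, exists u, code_power g k k' m l p q u,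
      forall p q p' q' u u',
        code_power g k k' m l p q u -> code_power g k k' m l p' q' u' ->
        (u = u' <-> aadd p q' = aadd p' q),
      forall u, code_centralizer g u <-> exists p q, code_power g k k' m l p q u &
      forall p q p' q' u u' v,
        code_power g k k' m l p q u -> code_power g k k' m l p' q' u' ->
        code_power g k k' m l (aadd p p') (aadd q q') v -> code_mul u u' v].

End InModel.

Lemma def_coding_sentence : definable (fun M (_ : 'I_0 -> M) => coding_sentence M).
Proof. rewrite /coding_sentence /in1 /code_len /code_comp; def idtac. Qed.

Lemma def_centralizer_sentence :
  definable (fun M (_ : 'I_0 -> M) => centralizer_sentence M).
Proof.
rewrite /centralizer_sentence /code_power /code_pos_power /code_centralizer /code_len.
def ltac:(first [apply: def_code_mul; tdef | apply: def_code_red; tdef]).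
Qed.

End Sentences.

(** * The sentences hold in the standard model *)

Section StandardSentences.

Variables (r : nat) (e : nat -> seq nat) (T : formula 3) (L : formula 2).
Hypotheses (e_bij : bijective e).
Hypotheses (T_def : defines_components e T) (L_def : defines_length e L).

Lemma coding_sentence_nat : coding_sentence T L natA.
Proof.
have LE := len_natE L_def; have CE := comp_natE T_def.
split; first by move=> n; exists (size (e n)); apply/LE.
split; first by move=> n k k' /LE<- /LE.
split; first by move=> n k a i /LE<- /CE[/in1_nat].
split; first by move=> n a b i /CE[_ <-] /CE[_ <-].
split.
  by move=> n k i /LE<- /in1_nat i_in; exists (nth 0 (e n) i.-1); apply/CE.
move=> n n' k /LE<- /LE sz_n' nn'; apply: (bij_inj e_bij).
apply: (@eq_from_nth _ 0) => // i lt_i.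
by have /nn'/CE[_ /=] := comp_nth T_def lt_i.
Qed.

Local Open Scope group_scope.
Implicit Types (x y : rword r) (k : rword r).

Definition generates_centralizer x k (m l : nat) :=
  [/\ 0 < l, forall n, size (k ^+ n.+1 : rword r) = m + n.+1 * l &
      forall y, commute x y <-> exists p q, y = k ^+ p / k ^+ q]%N.

Lemma commute_expVg k p q : k ^+ p / k ^+ q = k ^- q * k ^+ p.
Proof. by apply/commute_sym/commute_sym/commuteV/commuteX2. Qed.

Lemma generates_centralizerV x k m l :
  generates_centralizer x k m l -> generates_centralizer x k^-1 m l.
Proof.
case=> l0 sz_k cent; split=> // [n|y]; first by rewrite expVgn val_rinv size_invw.
rewrite cent; split=> -[p [q ->]]; exists q, p.
  by rewrite !expVgn invgK commute_expVg.
by rewrite !expVgn invgK -commute_expVg.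
Qed.

Variables (code : rword r -> nat) (code_e : forall x, e (code x) = x).

Lemma centralizer_natE x (u : nat) :
  code_centralizer T L r (M := natA) (code x) u <->
  exists2 y : rword r, e u = y & commute x y.
Proof.
have rx : red r (e (code x)) by rewrite code_e rwordP.
split=> [[/(red_natE _ T_def) ru [v [_]]]|[y uy xy]].
  move=> /(mul_natE T_def L_def _ rx ru) xu /(mul_natE T_def L_def _ ru rx).
  rewrite xu !code_e => ux; exists (RWord ru) => //.
  by apply: val_inj; rewrite /= -ux.
have ru : red r (e u) by rewrite uy rwordP.
split; first exact/(red_natE _ T_def).
exists (code (x * y)); split.
- by apply/(red_natE _ T_def); rewrite code_e rwordP.
- by apply/(mul_natE T_def L_def _ rx ru); rewrite !code_e uy.
- by apply/(mul_natE T_def L_def _ ru rx); rewrite !code_e uy xy.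
Qed.

Lemma pos_power_natE x k (m l d u : nat) : generates_centralizer x k m l ->
  code_pos_power T L r (M := natA) (code x) (code k) m l d u <-> e u = k ^+ d.+1 :> seq nat.
Proof.
case=> l0 sz_k cent; rewrite /code_pos_power /= !addn1.
have rk : red r (e (code k)) by rewrite code_e rwordP.
split=> [[/centralizer_natE[y uy /cent[p [q y_def]]] /(len_natE L_def) sz_u]|uk].
  move=> [v [+ /(len_natE L_def) sz_v]].
  have ru : red r (e u) by rewrite uy rwordP.
  move/(mul_natE T_def L_def _ rk ru); rewrite uy code_e => v_def.
  have {v_def sz_v} sz_ky : size (k * y : rword r) = m + d.+2 * l by rewrite -sz_v v_def.
  rewrite uy in sz_u *.
  case: (ltngtP p q) => [lt_pq|lt_qp|eq_pq].
  - have y_inv : y = k ^- (q - p).-1.+1.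
      by rewrite prednK ?subn_gt0 // expgnFr ?(ltnW lt_pq) // invgF.
    move: sz_u; rewrite y_inv val_rinv size_invw sz_k => /addnI/eqP.
    rewrite eqn_pmul2r // => /eqP[qp].
    (* For the negative power, [k * y = k ^- d] is too short for the prescribed length
       [m + d.+2 * l]. *)
    have : size (k * y : rword r) <= m + d * l.
      rewrite y_inv qp expgSr invgM mulgA mulgV mul1g val_rinv size_invw.
      by case: (d) => // d'; rewrite sz_k.
    by rewrite sz_ky leq_add2l leq_pmul2r // ltnNge leqnSn.
  - have y_pow : y = k ^+ (p - q).-1.+1.
      by rewrite prednK ?subn_gt0 // expgnFr // ltnW.
    move: sz_u; rewrite y_pow sz_k => /addnI/eqP.
    by rewrite eqn_pmul2r // => /eqP[->].
  (* Equal exponents make [y] empty, while the prescribed length is positive because [l] is. *)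
  by move: sz_u; rewrite y_def eq_pq mulgV /=; case: (m) (l) l0 => [|?] [].
have ru : red r (e u) by rewrite uk rwordP.
split; last exists (code (k ^+ d.+2)).
- apply/centralizer_natE; exists (k ^+ d.+1) => //; apply/cent.
  by exists d.+1, 0%N; rewrite invg1 mulg1.
- by apply/(len_natE L_def); rewrite uk sz_k.
split; last by apply/(len_natE L_def); rewrite code_e sz_k.
by apply/(mul_natE T_def L_def _ rk ru); rewrite !code_e uk expgS.
Qed.

Lemma power_natE x k (m l p q u : nat) : generates_centralizer x k m l ->
  code_power T L r (M := natA) (code x) (code k) (code k^-1) m l p q u <->
  e u = k ^+ p / k ^+ q :> seq nat.
Proof.
move=> gen; have genV := generates_centralizerV gen; rewrite /code_power.
split=> [[[-> [_ /(len_natE L_def)/size0nil ->]]|]|uk].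
- by rewrite mulgV.
- case=> -[d [-> /pos_power_natE]].
    move=> /(_ gen) ->; rewrite -[aadd _ _]/(q + (d + 1))%N addn1.
    by rewrite (addnC q) expgnDr mulgK.
  move=> /(_ genV) ->; rewrite -[aadd _ _]/(p + (d + 1))%N addn1.
  by rewrite expgnDr invgM mulgA commute_expVg -mulgA mulgV mulg1 expVgn.
case: (ltngtP p q) => [lt_pq|lt_qp|eq_pq].
- right; right; exists (q - p).-1.
  rewrite /= addn1 prednK ?subn_gt0 // subnKC ?(ltnW lt_pq) //.
  split=> //; apply/(pos_power_natE _ _ genV); rewrite prednK ?subn_gt0 //.
  by rewrite expVgn expgnFr ?(ltnW lt_pq) // invgF.
- right; left; exists (p - q).-1.
  rewrite /= addn1 prednK ?subn_gt0 // subnKC ?(ltnW lt_qp) //.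
  split=> //; apply/(pos_power_natE _ _ gen); rewrite prednK ?subn_gt0 //.
  by rewrite expgnFr // ltnW.
left; rewrite eq_pq mulgV in uk *; split=> //; split.
  by apply/centralizer_natE; exists 1 => //; rewrite /commute mulg1 mul1g.
by apply/(len_natE L_def); rewrite uk.
Qed.

(** The generator has infinite order, because powers with distinct natural exponents have distinct
    lengths. *)
Lemma expg_divg_eq x k m l p q p' q' : generates_centralizer x k m l ->
  k ^+ p / k ^+ q = k ^+ p' / k ^+ q' <-> (p + q' = p' + q)%N.
Proof.
case=> l0 sz_k _.
have size_inj : injective (fun n => size (k ^+ n : rword r)).
  case=> [|a] [|b] //; rewrite ?sz_k.
  - by case: (m) (l) l0 => [|?] [].
  - by case: (m) (l) l0 => [|?] [].
  by move=> /addnI/eqP; rewrite eqn_pmul2r // => /eqP.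
have k_inj a b : k ^+ a = k ^+ b -> a = b.
  by move=> ab; apply: size_inj; rewrite /= ab.
have divE a b c : k ^+ a / k ^+ b * k ^+ (b + c) = k ^+ (a + c).
  by rewrite !expgnDr mulgA mulgVK.
split=> [E|E].
  by apply: k_inj; rewrite -(divE p q) E addnC divE addnC.
by apply: (mulIg (k ^+ (q + q'))); rewrite divE [in RHS]addnC divE E.
Qed.

Lemma expg_divgM k p q p' q' :
  (k ^+ p / k ^+ q) * (k ^+ p' / k ^+ q') = k ^+ (p + p') / k ^+ (q + q').
Proof.
rewrite mulgA -(mulgA _ _ (k ^+ p')) -commute_expVg mulgA -expgnDr -mulgA -invgM.
by rewrite -expgnDr (addnC q).
Qed.

Lemma centralizer_sentence_nat : centralizer_sentence T L r natA.
Proof.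
move=> g /(red_natE _ T_def) rg g_n0; pose x := RWord rg.
have x1 : x != 1.
  by apply/negP => /eqP/(congr1 val) /= g0; apply/g_n0/(len_natE L_def); rewrite g0.
have [k [m [l gen]]] := centralizer_cyclic x1.
have <- : code x = g by apply: (bij_inj e_bij); rewrite code_e.
exists (code k), (code k^-1), m, l; split.
- move=> p q; exists (code (k ^+ p / k ^+ q)).
  by apply/(power_natE _ _ _ gen); rewrite code_e.
- move=> p q p' q' u u' /(power_natE _ _ _ gen) ep /(power_natE _ _ _ gen) ep'.
  rewrite -[aadd p q']/(p + q')%N -[aadd p' q]/(p' + q)%N -(expg_divg_eq _ _ _ _ gen).
  split=> [uu'|E]; first by apply: val_inj; rewrite /= -[LHS]ep uu' ep'.
  by apply: (bij_inj e_bij); rewrite ep ep' E.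
- move=> u; rewrite centralizer_natE; case: (gen) => _ _ cent; split.
    move=> [y uy /cent[p [q y_def]]]; exists p, q.
    by apply/(power_natE _ _ _ gen); rewrite uy y_def.
  move=> [p [q /(power_natE _ _ _ gen) up]]; exists (k ^+ p / k ^+ q) => //.
  by apply/cent; exists p, q.
move=> p q p' q' u u' v /(power_natE _ _ _ gen) up /(power_natE _ _ _ gen) up'.
move=> /(power_natE _ _ _ gen) vp.
apply/(mul_natE T_def L_def (r := r)); [by rewrite up rwordP | by rewrite up' rwordP |].
by rewrite up up' -val_rmul expg_divgM.
Qed.

End StandardSentences.

Import Order.TTheory GRing.Theory Num.Theory.

(** * Nonstandard words and their codes *)

(** The first clause makes the order of the nonstandard integers discrete. The other two say that
    every element is even or odd but not both; [zcode] distinguishes the signs by this parity. *)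
Definition arith_sentence (M : arith) :=
  (forall x : M, x = azero M \/ exists y, x = aadd y (aone M)) /\
  (forall x : M, exists y, x = aadd y y \/ x = aadd (aadd y y) (aone M)) /\
  (forall x y : M, aadd x x <> aadd (aadd y y) (aone M)).

Lemma def_arith_sentence : definable (fun M (_ : 'I_0 -> M) => arith_sentence M).
Proof. by rewrite /arith_sentence; def idtac. Qed.

Lemma arith_sentence_nat : arith_sentence natA.
Proof.
split; first by case=> [|x]; [left | right; exists x; rewrite /= addn1].
split; last by move=> x y /=; lia.
move=> /= x; exists x./2; have := odd_double_half x.
by case: odd => /= E; [right | left]; lia.
Qed.

Lemma choice_fun (A B : Type) (R : A -> B -> Prop) :
  (forall x, exists y, R x y) -> exists f, forall x, R x (f x).
Proof.
move=> H; exists (fun x => proj1_sig (constructive_indefinite_description _ (H x))).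
by move=> x; case: constructive_indefinite_description.
Qed.

Local Open Scope ring_scope.

Section Bridge.

Variables (T : formula 3) (L : formula 2) (r : nat).
Variables (M : arith) (Z : realDomainType) (iota : M -> Z).
Hypothesis Z_ring : ring_of iota.
Hypotheses (arithM : arith_sentence M) (codingM : coding_sentence T L M).

Local Notation code_len := (@code_len L M).
Local Notation code_comp := (@code_comp T M).
Local Notation code_mul := (@code_mul T L M).
Local Notation code_red := (@code_red T r M).
Local Notation word := (word M Z).
Local Notation zcode := (@zcode Z).

Let iotaD := Defs.iotaD Z_ring.
Let iota1 := iota1 Z_ring.
Let iota0 := iota0 Z_ring.
Let iota_inj := iota_inj Z_ring.

Lemma iota_ge0 x : 0 <= iota x.
Proof. by apply/(iota_nonneg Z_ring); exists x. Qed.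

Lemma iota_onto z : 0 <= z -> exists x, iota x = z.
Proof. by move/(iota_nonneg Z_ring). Qed.

Lemma aleE x y : ale x y <-> iota x <= iota y.
Proof.
split=> [[z <-]|]; first by rewrite iotaD lerDl iota_ge0.
rewrite -subr_ge0 => /iota_onto[z zE]; exists z; apply: iota_inj.
by rewrite iotaD zE addrC subrK.
Qed.

Lemma in1E k i : in1 k i <-> 1 <= iota i /\ iota i <= iota k.
Proof. by rewrite /in1 !aleE iota1. Qed.

Lemma iota_numeral k : iota (numeral M k) = k%:R.
Proof. by elim: k => //= k IHk; rewrite iotaD IHk iota1 -natr1 addrC. Qed.

Lemma Z_discrete (x y : Z) : x < y -> x + 1 <= y.
Proof.
rewrite -subr_gt0 => lt_xy; have [n nE] := iota_onto (ltW lt_xy).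
case: arithM => /(_ n)[n0|[m n_def]] _.
  by move: lt_xy; rewrite -nE n0 iota0 ltxx.
by move: nE (iota_ge0 m); rewrite n_def iotaD iota1; lra.
Qed.

Lemma Z_parity (x y : Z) : 0 <= x -> 0 <= y -> x *+ 2 <> y *+ 2 + 1.
Proof.
move=> /iota_onto[a <-] /iota_onto[b <-]; case: arithM => _ [_ odd_even] ab.
by apply: (odd_even a b); apply: iota_inj; rewrite !iotaD iota1 -!mulr2n.
Qed.

Lemma zcode_inj : injective zcode.
Proof.
have mixed (x y : Z) : 0 <= x -> y < 0 -> x *+ 2 <> - y *+ 2 - 1.
  move=> x0 /Z_discrete y0 xy; apply: (@Z_parity x (- y - 1)) => //; lra.
move=> x y; rewrite /zcode; case: (lerP 0 x) => x0; case: (lerP 0 y) => y0; try lra.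
  by move/mixed; case.
by move/esym/mixed; case.
Qed.

Lemma zcode_onto a : exists z, iota a = zcode z.
Proof.
case: arithM => _ [/(_ a)[y ya] _]; have y0 := iota_ge0 y; case: ya => ->.
  by exists (iota y); rewrite iotaD /zcode y0; lra.
exists (- iota y - 1); rewrite !iotaD iota1 /zcode.
by case: (lerP 0 _); lra.
Qed.

Lemma code_opp_zcode a b x y : x != 0 -> iota a = zcode x -> iota b = zcode y ->
  code_opp a b <-> y = - x.
Proof.
move=> x0 ax yb.
have codeN i : zcode (iota i + 1) = iota i *+ 2 + 1 + 1.
  by rewrite /zcode; case: (lerP 0 _); have := iota_ge0 i; lra.
have codeP i : zcode (- (iota i + 1)) = iota i *+ 2 + 1.
  by rewrite /zcode; case: (lerP 0 _); have := iota_ge0 i; lra.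
split.
  case=> i ab; move: ax yb; case: ab => -[-> ->]; rewrite !iotaD iota1 -mulr2n.
    by rewrite -codeN -codeP => /zcode_inj <- /zcode_inj <-; rewrite opprK.
  by rewrite -codeN -codeP => /zcode_inj <- /zcode_inj <-.
move=> y_def; subst y.
have [x_gt0|x_le0] := ltrP 0 x.
  have [|i iE] := @iota_onto (x - 1); first by have := Z_discrete x_gt0; lra.
  have {iE} x_def : x = iota i + 1 by lra.
  exists i; right; split; apply: iota_inj;
    rewrite ?ax ?yb !iotaD ?yb ?iota1 x_def ?codeN ?codeP; lra.
have x_lt0 : x < 0 by rewrite lt_neqAle x0.
have [|i iE] := @iota_onto (- x - 1); first by have := Z_discrete x_lt0; lra.
have {iE} x_def : x = - (iota i + 1) by lra.
exists i; left; split; apply: iota_inj;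
  rewrite ?ax ?yb !iotaD ?ax ?iota1 x_def ?opprK ?codeN ?codeP; lra.
Qed.

(** The way back from codes rests on discreteness: [1 <= 2z] has to give [1 <= z], and
    [-2z - 1 <= 2r] has to give [-z <= r]. *)
Lemma zcode_range z : 1 <= `|z| <= r%:R <-> 1 <= zcode z /\ zcode z <= (r.*2)%:R.
Proof.
have -> : (r.*2)%:R = r%:R *+ 2 :> Z by rewrite -muln2 natrM mulr_natr.
rewrite /zcode; split=> [/andP[]|[]].
  by case: (lerP 0 z) => [z0|z0]; [rewrite ger0_norm // | rewrite ltr0_norm //]; lra.
case: (lerP 0 z) => [z0|z0]; [rewrite ger0_norm // | rewrite ltr0_norm //] => z1 zr.
  by apply/andP; split; [have : 0 < z by lra | lra]; move/Z_discrete; lra.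
apply/andP; split; first by lra.
by case: (lerP (- z) r%:R) => // /Z_discrete; lra.
Qed.

Local Notation nonstd_word := (nonstd_word iota T L r).

(** A code determines letters only on [[1, len s]]; the last clause fixes the remaining values, so
    that a code represents at most one word. *)
Definition represents n (s : word) :=
  [/\ code_len n (len s),
      forall a i, code_comp n a i <-> in1 (len s) i /\ iota a = zcode (letter s i) &
      forall i, ~ in1 (len s) i -> letter s i = 0].

Lemma code_len_inj n k k' : code_len n k -> code_len n k' -> k = k'.
Proof. by case: codingM => _ [H _]; apply: H. Qed.

Lemma represents_inj n s s' : represents n s -> represents n s' -> s = s'.
Proof.
case: s s' => [k s] [k' s'] [/= nk ns s0] [/= nk' ns' s'0].
have kk' := code_len_inj nk nk'; subst k'; congr Word.
apply: functional_extensionality => i.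
have [i_in|i_out] := classic (in1 k i); last by rewrite s0 ?s'0.
have [_ [_ [_ [_ [/(_ n k i nk i_in)[a na] _]]]]] := codingM.
by apply: zcode_inj; have [/ns[_ <-] /ns'[_ <-]] := (na, na).
Qed.

Lemma represents_code_inj n n' s : represents n s -> represents n' s -> n = n'.
Proof.
case=> nk ns _ [n'k n's _]; have [_ [_ [_ [_ [_ H]]]]] := codingM.
by apply: H nk n'k _ => a i /ns/n's.
Qed.

Lemma nonzero_letter s i : nonstd_word s -> in1 (len s) i -> letter s i != 0.
Proof.
move=> sw /(w_range sw)/andP[s1 _]; apply: contraTneq s1 => ->.
by rewrite normr0 ler10.
Qed.

Lemma code_of_word s : nonstd_word s -> exists2 n, represents n s & code_red n.
Proof.
move=> sw; have [t [n [nk nt]] ts] := w_tuple sw.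
have ns a i : code_comp n a i <-> in1 (len s) i /\ iota a = zcode (letter s i).
  rewrite [code_comp _ _ _]nt; split=> -[i_in]; first by move=> <-; rewrite ts.
  by rewrite -ts // => /iota_inj.
exists n; first by split=> //; exact: w_out sw.
split=> [a i /ns[i_in ai]|a b i /ns[i_in ai] /ns[i1_in bi]].
  by rewrite !aleE iota1 iota_numeral ai; apply/zcode_range; exact: w_range sw i i_in.
have si0 := nonzero_letter sw i_in.
move=> /(code_opp_zcode si0 ai bi) si1; apply: (w_reduced sw i_in.1 i1_in.2).
by rewrite si1 opprK.
Qed.

Lemma word_of_code n : code_red n -> exists2 s, represents n s & nonstd_word s.
Proof.
case=> n_range n_red.
have [k nk] : exists k, code_len n k by case: codingM.
have [_ [_ [n_in [n_fun [n_ex _]]]]] := codingM.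
have [t nt] : exists t, forall i, in1 k i -> code_comp n (t i) i.
  apply: (choice_fun (R := fun i a => in1 k i -> code_comp n a i)) => i.
  (* Outside [[1, k]] the value is arbitrary, and [i] serves as one. *)
  have [i_in|i_out] := classic (in1 k i); last by exists i.
  by have [a na] := n_ex n k i nk i_in; exists a.
(* Decode each component; the default value 0 outside [[1, k]] is the one that [w_out]
   prescribes. *)
have [s [ts s0]] : exists s : M -> Z, (forall i, in1 k i -> iota (t i) = zcode (s i)) /\
    (forall i, ~ in1 k i -> s i = 0).
  have [|s ss] := @choice_fun M Z (fun i z => (in1 k i -> iota (t i) = zcode z) /\
    (~ in1 k i -> z = 0)); last by exists s; split=> i; case: (ss i).
  move=> i; have [i_in|i_out] := classic (in1 k i); last by exists 0.
  by have [z tz] := zcode_onto (t i); exists z.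
have ns a i : code_comp n a i <-> in1 k i /\ iota a = zcode (s i).
  split=> [na|[i_in]]; last by rewrite -ts // => /iota_inj->; exact: nt.
  have i_in := n_in _ _ _ _ nk na; split=> //.
  by rewrite -ts // (n_fun _ _ _ _ na (nt i i_in)).
exists (Word k s); first by [].
split=> //=.
- exists t => //; exists n; split=> // a i; split=> [na|[i_in <-]]; last exact: nt.
  have i_in := n_in _ _ _ _ nk na; split=> //.
  exact: n_fun (nt i i_in) na.
- move=> i i_in; have [] := n_range _ _ (nt i i_in).
  by rewrite !aleE iota1 iota_numeral ts // => H1 H2; apply/zcode_range.
move=> i i1 ik si.
have i_in : in1 k i.
  by split=> //; move: ik; rewrite !aleE iotaD iota1; lra.
have i1_in : in1 k (aadd i (aone M)).
  by split=> //; rewrite aleE iotaD iota1; have := iota_ge0 i; lra.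
apply: (n_red _ _ _ (nt _ i_in) (nt _ i1_in)).
have si0 : s i != 0.
  apply/eqP => si0; have [] := n_range _ _ (nt _ i_in).
  by rewrite aleE iota1 ts // si0 /zcode lexx mul0rn ler10.
by apply/(code_opp_zcode si0 (ts _ i_in) (ts _ i1_in)); rewrite si opprK.
Qed.

Lemma code_cancelsE n n' s t l : represents n s -> represents n' t ->
  nonstd_word s -> code_cancels T L n n' l <-> cancels s t l.
Proof.
move=> [nk ns _] [n'k n't _] sw; have [_ [_ [_ [_ [n_ex _]]]]] := codingM.
split=> [[k [k' [/(code_len_inj nk) <- /(code_len_inj n'k) <- ls lt H]]]|[ls lt H]].
  split=> // i j j_in ij.
  have ijE : iota i + iota j = iota (len s) + 1 by rewrite -iotaD ij iotaD iota1.
  move: (ls) (lt) (j_in) => /aleE ls' /aleE lt' /in1E[j1 jl].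
  have i_in : in1 (len s) i by apply/in1E; lra.
  have jt_in : in1 (len t) j by apply/in1E; lra.
  have [a na] := n_ex _ _ _ nk i_in; have [b n'b] := n_ex _ _ _ n'k jt_in.
  have si0 := nonzero_letter sw i_in.
  have [[_ ai] [_ bj]] := ((ns _ _).1 na, (n't _ _).1 n'b).
  by apply/(code_opp_zcode si0 ai bj); exact: H j_in ij _ _ na n'b.
exists (len s), (len t); split=> // i j j_in ij a b /ns[i_in ai] /n't[_ bj].
by apply/(code_opp_zcode (nonzero_letter sw i_in) ai bj); exact: H.
Qed.

Lemma code_mulE n n' p s t u : represents n s -> represents n' t -> represents p u ->
  nonstd_word s -> code_mul n n' p <-> wmul s t u.
Proof.
move=> rn rn' rp sw.
have can l := code_cancelsE l rn rn' sw.
have [[nk ns _] [n'k n't _] [pk pu _]] := And3 rn rn' rp.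
have [_ [_ [_ [_ [n_ex _]]]]] := codingM.
(* Equality of two letters becomes an implication between components, since each position carries a
   component and [zcode] is injective. *)
have same x y i j k k' : represents x k -> represents y k' -> in1 (len k) i ->
    in1 (len k') j -> (letter k i = letter k' j <->
    forall a, code_comp x a i -> code_comp y a j).
  move=> [xl xk _] [yl yk _] i_in j_in; split=> [E a /xk[_ ai]|H].
    by apply/yk; rewrite -E.
  have [a xa] := n_ex _ _ _ xl i_in; have [_ ai] := (xk _ _).1 xa.
  by apply: zcode_inj; rewrite -ai; case/H/yk: xa.
split=> -[l [c [d H]]]; exists l, c, d.
  case: H => -[/can cl max_l] [/(code_len_inj nk) sE /(code_len_inj n'k) tE].
  move=> /(code_len_inj pk) uE Hc Hd.
  split=> //.
  - by split=> // l' /can /max_l.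
  - move=> i i_in; have/in1E i_in' := i_in.
    apply/(same _ _ _ _ _ _ rp rn); last exact: Hc.
      by apply/in1E; rewrite uE iotaD; have := iota_ge0 d; lra.
    by apply/in1E; rewrite sE iotaD; have := iota_ge0 l; lra.
  move=> i i_in; have/in1E i_in' := i_in.
  apply/(same _ _ _ _ _ _ rp rn'); last exact: Hd.
    by apply/in1E; rewrite uE !iotaD; have := iota_ge0 c; lra.
  by apply/in1E; rewrite tE !iotaD; have := iota_ge0 l; lra.
case: H => -[/can cl max_l] [sE tE] uE Hc Hd.
split; rewrite -?sE -?tE -?uE //.
- by split=> // l' /can /max_l.
- move=> i i_in; have/in1E i_in' := i_in.
  apply/(same _ _ _ _ _ _ rp rn); last exact: Hc.
    by apply/in1E; rewrite uE iotaD; have := iota_ge0 d; lra.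
  by apply/in1E; rewrite sE iotaD; have := iota_ge0 l; lra.
move=> i i_in; have/in1E i_in' := i_in.
apply/(same _ _ _ _ _ _ rp rn'); last exact: Hd.
  by apply/in1E; rewrite uE !iotaD; have := iota_ge0 c; lra.
by apply/in1E; rewrite tE !iotaD; have := iota_ge0 l; lra.
Qed.

End Bridge.

(** * The isomorphism onto the centralizer in the nonstandard free group *)

Theorem proposition5p2
  (r : nat)
  (e : nat -> seq nat) (e_bij : bijective e) (e_comp : computable_enum e)
  (T : formula 3) (L : formula 2)
  (T_def : defines_components e T) (L_def : defines_length e L)
  (Nt : arith) (Nt_equiv : elem_equiv Nt natA)
  (Zt : realDomainType) (iota : Nt -> Zt) (Zt_ring : ring_of iota)
  (g : word Nt Zt) (g_in : nonstd_word iota T L r g) (g_neq1 : g <> wone Nt Zt) :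
  isog_Zplus (centralizer iota T L r g).
Proof.
have arithN := transfer def_arith_sentence Nt_equiv arith_sentence_nat.
have codingN :=
  transfer (def_coding_sentence T L) Nt_equiv (coding_sentence_nat e_bij T_def L_def).
have centralN : centralizer_sentence T L r Nt.
  apply: transfer (def_centralizer_sentence T L r) Nt_equiv _.
  case: (e_bij) => e' _ e'K.
  apply: (centralizer_sentence_nat e_bij T_def L_def (code := fun x => e' x)).
  by move=> x; exact: e'K.
have [n ng nW] := code_of_word Zt_ring arithN g_in.
have n_neq0 : ~ code_len L n (azero Nt).
  case: (ng) => nk _ g0 /(code_len_inj codingN nk) len0; apply: g_neq1.
  (* A word of length zero has no positions, so all its values are the default 0 and it equals
     [wone]. *)
  case: g g_in g0 len0 {ng nk} => k s _ /= s0 k0; subst k; congr Word.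
  apply: functional_extensionality => i; apply: s0 => /(in1E Zt_ring).
  by rewrite (iota0 Zt_ring) => -[]; lra.
have [k [k' [m [l]]]] := centralN n nW n_neq0.
set wpow := code_power _ _ _ _ _ _ _ _ => -[pow_ex pow_eq pow_cent pow_mul].
have centE u h : represents T L iota u h ->
    code_centralizer T L r n u <-> centralizer iota T L r g h.
  move=> uh; split.
    move=> [uW [v [vW nu un]]].
    have [h' uh' hW] := word_of_code Zt_ring arithN codingN uW.
    rewrite (represents_inj Zt_ring arithN codingN uh uh').
    have [w vw wW] := word_of_code Zt_ring arithN codingN vW.
    split=> //; exists w; split=> //.
      exact/(code_mulE Zt_ring arithN codingN ng uh' vw g_in).
    exact/(code_mulE Zt_ring arithN codingN uh' ng vw hW).
  move=> [hW [w [wW gh hg]]].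
  have [u' u'h u'W] := code_of_word Zt_ring arithN hW.
  rewrite (represents_code_inj codingN uh u'h).
  have [v vw vW] := code_of_word Zt_ring arithN wW.
  split=> //; exists v; split=> //.
    exact/(code_mulE Zt_ring arithN codingN ng u'h vw g_in).
  exact/(code_mulE Zt_ring arithN codingN u'h ng vw hW).
(* An integer is written as a difference in many ways; [graph_eq] shows that the word depends on the
   difference alone and that distinct differences give distinct words. *)
pose graph z h := exists p q u,
  [/\ z = iota p - iota q, wpow p q u & represents T L iota u h].
have [f fE] : exists f, forall z, graph z (f z).
  apply: choice_fun => z.
  have [p [q zE]] : exists p q, z = iota p - iota q.
    have [/(iota_onto Zt_ring)[p pE]|/ltW] := lerP 0 z.
      by exists p, (azero Nt); rewrite pE (iota0 Zt_ring) subr0.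
    rewrite -oppr_ge0 => /(iota_onto Zt_ring)[q qE].
    by exists (azero Nt), q; rewrite qE (iota0 Zt_ring) sub0r opprK.
  have [u pu] := pow_ex p q.
  have [|uW _] := (pow_cent u).2; first by exists p, q.
  have [h uh _] := word_of_code Zt_ring arithN codingN uW.
  by exists h, p, q, u.
have diffE p q p' q' : aadd p q' = aadd p' q <-> iota p - iota q = iota p' - iota q'.
  split=> [/(congr1 iota)|E]; first by rewrite !(Defs.iotaD Zt_ring); lra.
  by apply: (iota_inj Zt_ring); rewrite !(Defs.iotaD Zt_ring); lra.
have graph_eq z z' h h' : graph z h -> graph z' h' -> h = h' <-> z = z'.
  move=> [p [q [u [-> pu uh]]]] [p' [q' [u' [-> pu' uh']]]].
  rewrite -diffE -(pow_eq _ _ _ _ _ _ pu pu'); split=> E.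
    by rewrite -E in uh'; exact: (represents_code_inj codingN uh uh').
  by rewrite -E in uh'; exact: (represents_inj Zt_ring arithN codingN uh uh').
exists f; split.
- by move=> z z' ff; apply/(graph_eq _ _ _ _ (fE z) (fE z')).
- move=> h; split=> [hC|[z <-]].
    have [u uh _] := code_of_word Zt_ring arithN hC.1.
    have /(centE _ _ uh)/pow_cent[p [q pu]] := hC.
    exists (iota p - iota q); apply/(graph_eq _ _ _ _ (fE _) _); last by [].
    by exists p, q, u.
  have [p [q [u [_ pu uh]]]] := fE z.
  by apply/(centE _ _ uh)/pow_cent; exists p, q.
move=> z z'; have [p [q [u [zE pu uh]]]] := fE z.
have [p' [q' [u' [z'E pu' uh']]]] := fE z'.
have [P [Q [v [vE pv vh]]]] := fE (z + z').
(* The pair [(P, Q)] chosen for [z + z'] need not be the sum of the other two pairs, but it has the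
   same difference, hence the same code. *)
have [v' pv'] := pow_ex (aadd p p') (aadd q q').
have vv' : v = v'.
  apply/(pow_eq _ _ _ _ _ _ pv pv')/diffE.
  by rewrite -vE zE z'E !(Defs.iotaD Zt_ring); lra.
have [|uW _] := (pow_cent u).2; first by exists p, q.
have [h uh2 hW] := word_of_code Zt_ring arithN codingN uW.
rewrite -(represents_inj Zt_ring arithN codingN uh uh2) in hW.
apply/(code_mulE Zt_ring arithN codingN uh uh' vh hW).
by rewrite vv' in pv vh *; exact: pow_mul pu pu' pv'.
Qed.
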